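(* Let $\kappa$ be a cardinal with $2\le\kappa\le\aleph_0$ and let $F_\kappa$ be the free group of rank $\kappa$. Then for every cardinal $\mu$ with $0\le\mu\le\aleph_0$ there exists a subgroup $H\leqslant F_\kappa$ such that $H\simeq F_\mu$, the free group of rank $\mu$.
   Context: Cardinals $\kappa,\mu$ range over the natural numbers (including $0$) together with $\aleph_0$, within the stated bounds. The free group of rank $0$ is the trivial group. *)

(* Defs.v *)
From HB Require Import structures.
From mathcomp Require Import all_boot.

Set Implicit Arguments.
Unset Strict Implicit.
Unset Printing Implicit Defensive.

Local Open Scope group_scope.

(* A cardinal in {0, 1, 2, ...} together with aleph_0. *)
Inductive countable_cardinal := Fin of nat | Aleph0.

Definition card_le (k l : countable_cardinal) : bool :=
  match k, l with
  | Fin m, Fin n => (m <= n)%N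
  | Aleph0, Fin _ => false
  | _, Aleph0 => true
  end.

Definition basis (k : countable_cardinal) : choiceType :=
  match k with Fin n => 'I_n | Aleph0 => nat end.

(* The letter (false, x) stands for x and (true, x) for its formal inverse. *)
Definition letter (X : Type) : Type := (bool * X)%type.

Definition invl (X : Type) (a : letter X) : letter X := (~~ a.1, a.2).

Definition reduced (X : choiceType) (w : seq (letter X)) : bool :=
  sorted (fun a b => b != invl a) w.

(* The free group on X, realized as the set of reduced words over X and its
   formal inverses; freeGroup_universal below gives its universal property. *)
Record freeGroup (X : choiceType) : Type :=
  FreeGroup { word :> seq (letter X); word_reduced : reduced word }.

HB.instance Definition _ (X : choiceType) := [isSub for @word X].
HB.instance Definition _ (X : choiceType) := [Choice of freeGroup X by <:].

(* Left multiplication of a reduced word by a letter. *)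
Definition consr (X : choiceType) (a : letter X) (w : seq (letter X)) :=
  if w is b :: w' then if b == invl a then w' else a :: w else [:: a].

Definition mulw (X : choiceType) (u v : seq (letter X)) := foldr (@consr X) v u.

Definition invw (X : Type) (u : seq (letter X)) := rev (map (@invl X) u).

Section FreeGroupStructure.
Variable X : choiceType.
Implicit Types (a b : letter X) (u v w : seq (letter X)).

Lemma invlK : involutive (@invl X).
Proof. by case=> b x; rewrite /invl /= negbK. Qed.

Lemma reduced_cons a w : reduced (a :: w) -> reduced w.
Proof. exact: path_sorted. Qed.

Lemma reduced_consr a w : reduced w -> reduced (consr a w).
Proof.
case: w => [//|b w] rw /=; case: ifP => [_|ba]; first exact: reduced_cons rw.
by rewrite /reduced /= ba.
Qed.

Lemma consrK a w : reduced w -> consr (invl a) (consr a w) = w.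
Proof.
case: w => [_|b w rw] /=; first by rewrite invlK eqxx.
case: eqP => [eb|_] /=; last by rewrite invlK eqxx.
case: w rw => [|c w] /=; first by rewrite eb.
by rewrite /reduced /= eb => /andP[/negbTE-> _].
Qed.

Lemma reduced_mulw u v : reduced v -> reduced (mulw u v).
Proof. by move=> rv; elim: u => //= a u; apply: reduced_consr. Qed.

Lemma mulw1 u : reduced u -> mulw u [::] = u.
Proof.
elim: u => //= a u IHu r; rewrite IHu; last exact: reduced_cons r.
by case: u {IHu} r => //= b u; rewrite /reduced /= => /andP[/negbTE-> _].
Qed.

Lemma mulw_consr a u v :
  reduced v -> mulw (consr a u) v = consr a (mulw u v).
Proof.
case: u => //= b u rv; case: eqP => //= ->.
by rewrite -{1}[a]invlK consrK //; apply: reduced_mulw.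
Qed.

Lemma mulwA u v w : reduced w -> mulw u (mulw v w) = mulw (mulw u v) w.
Proof. by move=> rw; elim: u => //= a u ->; rewrite mulw_consr. Qed.

Lemma invwK : involutive (@invw X).
Proof. by move=> u; rewrite /invw map_rev revK (mapK invlK). Qed.

Lemma reduced_invw u : reduced u -> reduced (invw u).
Proof.
rewrite /reduced /invw rev_sorted sorted_map; apply: sub_sorted => a b /=.
rewrite (inj_eq (inv_inj invlK)) -[b in b != _]invlK.
by rewrite (inj_eq (inv_inj invlK)) eq_sym.
Qed.

Lemma mulVw u w : reduced w -> mulw (invw u) (mulw u w) = w.
Proof.
move=> rw; elim: u => //= a u IHu; rewrite /invw /= rev_cons /mulw foldr_rcons.
by rewrite consrK //; apply: reduced_mulw.
Qed.

Definition fg_one : freeGroup X := @FreeGroup X [::] isT.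
Definition fg_mul (x y : freeGroup X) : freeGroup X :=
  FreeGroup (reduced_mulw x (word_reduced y)).
Definition fg_inv (x : freeGroup X) : freeGroup X :=
  FreeGroup (reduced_invw (word_reduced x)).

Lemma fg_mulA : associative fg_mul.
Proof. by move=> x y z; apply/val_inj/mulwA/word_reduced. Qed.
Lemma fg_mul1 : left_id fg_one fg_mul.
Proof. by move=> x; apply: val_inj. Qed.
Lemma fg_mulr1 : right_id fg_one fg_mul.
Proof. by move=> x; apply/val_inj/mulw1/word_reduced. Qed.
Lemma fg_mulV : left_inverse fg_one fg_inv fg_mul.
Proof.
move=> x; apply: val_inj => /=.
by rewrite -[X in mulw _ X](mulw1 (word_reduced x)) mulVw.
Qed.
Lemma fg_mulrV : right_inverse fg_one fg_inv fg_mul.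
Proof.
move=> x; rewrite -[x in fg_mul x _](_ : fg_inv (fg_inv x) = x) ?fg_mulV //.
by apply: val_inj; apply: invwK.
Qed.

End FreeGroupStructure.

HB.instance Definition _ (X : choiceType) := isGroup.Build (freeGroup X)
  (@fg_mulA X) (@fg_mul1 X) (@fg_mulr1 X) (@fg_mulV X) (@fg_mulrV X).

Definition fg_gen (X : choiceType) (x : X) : freeGroup X :=
  @FreeGroup X [:: (false, x)] isT.

Section Universal.
Variables (X : choiceType) (G : groupType) (f : X -> G).

Definition eval_letter (a : letter X) : G :=
  if a.1 then (f a.2)^-1 else f a.2.

Definition fg_lift (x : freeGroup X) : G := \prod_(a <- word x) eval_letter a.

Lemma eval_invl a : eval_letter (invl a) = (eval_letter a)^-1.
Proof. by case: a => [[] x]; rewrite /eval_letter /= ?invgK. Qed.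

Lemma fg_liftM : {morph fg_lift : x y / x * y}.
Proof.
move=> x y; rewrite /fg_lift /=; elim: (word x) => [|a u IHu] /=.
  by rewrite big_nil mul1g.
rewrite big_cons -mulgA -IHu; case: (mulw u y) => [|b w] /=.
  by rewrite big_seq1 big_nil mulg1.
case: eqP => [->|_]; last by rewrite big_cons.
by rewrite big_cons eval_invl mulVKg.
Qed.

HB.instance Definition _ := isMultiplicative.Build _ _ fg_lift fg_liftM.

Theorem freeGroup_universal :
  exists2 h : {multiplicative freeGroup X -> G},
    forall x, h (fg_gen x) = f x &
    forall h' : {multiplicative freeGroup X -> G},
      (forall x, h' (fg_gen x) = f x) -> h' =1 h.
Proof.
exists fg_lift => [x|h' h'f x] /=; first by rewrite /fg_lift big_seq1.
have h1 : h' 1 = 1.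
  by apply: (mulgI (h' 1)); rewrite -gmulfM !mulg1.
have hV y : h' y^-1 = (h' y)^-1.
  by apply: (mulgI (h' y)); rewrite -gmulfM !mulgV.
rewrite /fg_lift; case: x => w /=; elim: w => [|a w IHw] r /=.
  by rewrite big_nil -h1; congr (h' _); apply: val_inj.
have ra : reduced [:: a] by [].
have -> : FreeGroup r = FreeGroup ra * FreeGroup (reduced_cons r).
  apply: val_inj => /=; case: w r {IHw} => //= b w.
  by rewrite /reduced /= => /andP[/negbTE-> _].
rewrite gmulfM big_cons IHw; congr (_ * _).
case: a {r} ra => [[] x] ra; rewrite /eval_letter /= -h'f -?hV;
  by congr (h' _); apply: val_inj.
Qed.

End Universal.

Definition free_group_of_rank (k : countable_cardinal) : groupType :=
  freeGroup (basis k).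

(* A subgroup of G, given as a predicate closed under the group operations,
   regarded as a group in its own right. *)
Definition subgroup (G : groupType) (S : groupClosed G) : Type :=
  {x : G | x \in S}.

Lemma groupClosed_closed (G : groupType) (S : groupClosed G) :
  group_closed (mem S).
Proof.
split=> [|x y Sx Sy]; first exact: gpred1.
by apply: gpredM => //; apply: gpredVr.
Qed.

HB.instance Definition _ (G : groupType) (S : groupClosed G) :=
  SubChoice.on (subgroup S).
HB.instance Definition _ (G : groupType) (S : groupClosed G) :=
  SubChoice_isSubGroup.Build G (mem S) (subgroup S) (groupClosed_closed S).

Definition isomorphic (G H : groupType) : Prop :=
  exists f : {multiplicative G -> H}, bijective f.

(* Main.v *)
Require Import Defs.
From HB Require Import structures.
From mathcomp Require Import all_boot ssralg ssrint.

(** For distinct basis elements [a] and [b], the elements [a ^- n * b * a ^+ n]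
    freely generate a subgroup. To decode it, let the free group act on pairs
    [(s, y)] of an integer and an element of the free group of rank [mu]: [a]
    increments [s], and [b] multiplies [y] on the left by the [s]-th generator.
    Then [a ^- n * b * a ^+ n] multiplies the second component of [(0, y)] by
    the [n]-th generator, so acting on [(0, 1)] inverts the embedding. *)

Set Implicit Arguments.
Unset Strict Implicit.
Unset Printing Implicit Defensive.

Local Open Scope group_scope.

Section SplitImage.
Variables (G H : groupType) (f : {multiplicative G -> H}) (r : H -> G).
Hypothesis fK : cancel f r.

(** Membership in the image of [f] has to be boolean; the retraction [r] turns the existential into
    an equality test. *)
Definition split_image : {pred H} := fun x => f (r x) == x.

Lemma split_imageP x : reflect (exists u, x = f u) (x \in split_image).
Proof.
by apply: (iffP eqP) => [<-|[u ->]]; [exists (r x) | rewrite fK].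
Qed.

Lemma split_image_closed : group_closed split_image.
Proof.
have f1 : f 1 = 1 by apply: (mulgI (f 1)); rewrite -gmulfM !mulg1.
have fV u : f u^-1 = (f u)^-1.
  by apply: (mulgI (f u)); rewrite -gmulfM !mulgV.
split=> [|x y /split_imageP[u ->] /split_imageP[v ->]]; apply/split_imageP.
  by exists 1.
by exists (u / v); rewrite gmulfM fV.
Qed.

HB.instance Definition _ := isMulClosed.Build H split_image
  (group_closedM split_image_closed).
HB.instance Definition _ := isMul1Closed.Build H split_image
  (proj1 split_image_closed).
HB.instance Definition _ := isInvClosed.Build H split_image
  (group_closedV split_image_closed).

Lemma split_embedding_subgroup :
  exists S : groupClosed H, isomorphic (subgroup S) G.
Proof.
pose S : groupClosed H := split_image; exists S.
pose g (x : subgroup S) := r (val x).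
have gK x : f (g x) = val x by apply/eqP; exact: (valP x).
(* [r] is a mere function on [H], but inverting the injective morphism [f] on its image is
   multiplicative. *)
have gM : {morph g : x y / x * y}.
  move=> x y; apply: (can_inj fK).
  by rewrite gmulfM !gK valM.
pose gm := isMultiplicative.Build _ _ g gM.
pose gg : {multiplicative subgroup S -> G} := HB.pack g gm.
have fS u : f u \in S by apply/split_imageP; exists u.
exists gg; exists (fun u => Sub (f u) (fS u)) => [x|u].
  by apply: val_inj; rewrite SubK gK.
by rewrite /= /g SubK fK.
Qed.

End SplitImage.

Section Action.
Variables (X : choiceType) (a b : X) (G : groupType) (c : int -> G).
Hypothesis neq_ba : b != a.

(** The counter is an integer rather than a natural number so that decrementing inverts
    incrementing; letters other than [a] and [b] act trivially. *)
Definition act_letter (l : letter X) (p : int * G) : int * G :=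
  if l.2 == a then ((if l.1 then p.1 - 1 else p.1 + 1)%R, p.2)
  else if l.2 == b then (p.1, (if l.1 then (c p.1)^-1 else c p.1) * p.2)
  else p.

Definition act (x : freeGroup X) (p : int * G) := foldr act_letter p (word x).

Lemma act_letterK l : cancel (act_letter l) (act_letter (invl l)).
Proof.
case: l => e x [s y]; rewrite /act_letter /invl /=.
case: eqP => _ /=; first by case: e; rewrite /= ?GRing.subrK ?GRing.addrK.
by case: eqP => _ //=; case: e; rewrite /= ?mulVKg ?mulKg.
Qed.

Lemma actM x y p : act (x * y) p = act x (act y p).
Proof.
rewrite /act /=; elim: (word x) => //= l u <-.
(* If [l] cancels against the head of [mulw u y], the two letters act by mutually inverse maps. *)
case: (mulw u y) => //= m w; case: eqP => // ->.
by rewrite -{1}[l]invlK act_letterK.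
Qed.

Lemma actVK x : cancel (act x) (act x^-1).
Proof. by move=> p; rewrite -actM mulVg. Qed.

Lemma act_genX n s y : act (fg_gen a ^+ n) (s, y) = ((s + n%:Z)%R, y).
Proof.
elim: n => [|n IHn]; first by rewrite GRing.addr0.
rewrite expgS actM IHn /act /= /act_letter /= eqxx /=.
by rewrite -GRing.addrA -PoszD addn1.
Qed.

Definition conj_gen n := fg_gen a ^- n * fg_gen b * fg_gen a ^+ n.

Lemma act_conj_gen n y : act (conj_gen n) (0%R, y) = (0%R, c n * y).
Proof.
rewrite !actM act_genX GRing.add0r.
rewrite {2}/act /= /act_letter /= (negbTE neq_ba) eqxx /=.
(* The state [(n, c n * y)] is rewritten as the image of [(0, c n * y)] under the [n]-th power of
   [a], which [a ^- n] undoes. *)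
have /= := act_genX n 0%R (c n * y); rewrite GRing.add0r => <-.
exact: actVK.
Qed.

End Action.

(** Both maps are morphisms fixing the generators, so uniqueness in the universal property
    identifies them. *)
Lemma fg_lift_gen (X : choiceType) : fg_lift (@fg_gen X) =1 id.
Proof.
have [h _ h_uniq] := freeGroup_universal (@fg_gen X) => x.
rewrite (h_uniq (fg_lift (@fg_gen X))) => [|z]; last by rewrite /= /fg_lift big_seq1.
by rewrite -(h_uniq idfun).
Qed.

Lemma free_group_split_embedding (Y : countType) (X : choiceType) (a b : X) :
  b != a ->
  exists (f : {multiplicative freeGroup Y -> freeGroup X})
         (r : freeGroup X -> freeGroup Y), cancel f r.
Proof.
move=> neq_ba.
(* At the code [pickle y] this is the generator [y]; the absolute value and the default [1] make it
   total on integers. *)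
pose c (s : int) : freeGroup Y := oapp (@fg_gen Y) 1 (unpickle `|s|%N).
pose g (y : Y) : freeGroup X := conj_gen a b (pickle y).
exists (fg_lift g), (fun x => (act a b c x (0%R, 1)).2) => w.
(* Allowing any word [u], reduced or not, makes induction direct; at [z = 1] the second component is
   the lift of the generators, hence [w]. *)
suff act_lift u z :
    act a b c (\prod_(l <- u) eval_letter g l) (0%R, z) =
    (0%R, \prod_(l <- u) eval_letter (@fg_gen Y) l * z).
  by rewrite act_lift mulg1 -[RHS]fg_lift_gen.
have act_g x v : act a b c (g x) (0%R, v) = (0%R, fg_gen x * v).
  by rewrite act_conj_gen // /c absz_nat pickleK.
elim: u => [|l u IHu]; first by rewrite !big_nil mul1g.
rewrite !big_cons actM IHu -mulgA; set t := _ * z.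
case: l => [[] x]; rewrite /eval_letter /=; last exact: act_g.
(* For an inverse letter, [(0, t)] is exhibited as an image under [g x], which the inverse then
   strips. *)
by rewrite -{1}[t](mulVKg (fg_gen x)) -act_g actVK.
Qed.

Theorem mainTheorem1 (kappa : countable_cardinal)
    (kappa_ge2 : card_le (Fin 2) kappa) (mu : countable_cardinal) :
  exists H : groupClosed (free_group_of_rank kappa),
    isomorphic (subgroup H) (free_group_of_rank mu).
Proof.
have [a [b neq_ba]] : exists a b : basis kappa, b != a.
  case: kappa kappa_ge2 => [[|[|n]]|] //= _; last by exists 0%N, 1%N.
  by exists ord0, ord_max.
suff [f [r fK]] :
    exists (f : {multiplicative free_group_of_rank mu -> free_group_of_rank kappa})
           r, cancel f r by exact: split_embedding_subgroup fK.
(* In each case the basis becomes a concrete [countType], as the coding by [pickle] requires. *)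
case: mu => [n|].
  exact: (@free_group_split_embedding 'I_n _ _ _ neq_ba).
exact: (@free_group_split_embedding nat _ _ _ neq_ba).
Qed.
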